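(* Let $\alpha,\beta>0$ be constants and consider the port-Hamiltonian system $$\dot{\mathbf{x}}=[J(\mathbf{x})-R(\mathbf{x})]\nabla H(\mathbf{x})+B(\mathbf{x})\mathbf{d}+C(\mathbf{x})\mathbf{u}$$ with state $\mathbf{x}\in\mathbb{R}^n$, disturbance $\mathbf{d}\in\mathbb{R}^k$ and control input $\mathbf{u}\in\mathbb{R}^m$. Let the control input be given by the state feedback $\mathbf{u}=\mathbf{h}(\mathbf{x})$ with $\mathbf{h}:\mathbb{R}^n\to\mathbb{R}^m$. If $$\nabla H(\mathbf{x})^\top\Big[C(\mathbf{x})\mathbf{h}(\mathbf{x})+\frac{1}{4\beta}B(\mathbf{x})B(\mathbf{x})^\top\nabla H(\mathbf{x})-R(\mathbf{x})\nabla H(\mathbf{x})\Big]+\alpha H(\mathbf{x})\le 0\qquad\text{for all }\mathbf{x}\in\mathbb{R}^n,$$ then the system with control input $\mathbf{u}=\mathbf{h}(\mathbf{x})$ is input-to-state stable (with these constants $\alpha,\beta$).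
   Context: In a port-Hamiltonian system, for every $\mathbf{x}\in\mathbb{R}^n$, $J(\mathbf{x})\in\mathbb{R}^{n\times n}$ is skew-symmetric, $R(\mathbf{x})\in\mathbb{R}^{n\times n}$ is symmetric positive semi-definite, and $B(\mathbf{x})\in\mathbb{R}^{n\times k}$, $C(\mathbf{x})\in\mathbb{R}^{n\times m}$ are arbitrary matrices; $H:\mathbb{R}^n\to\mathbb{R}$ is a (differentiable) scalar function called the Hamiltonian, with gradient $\nabla H$ (a column vector). Definition (ISS, as used here): the port-Hamiltonian system is called input-to-state stable if, along its solutions, $H$ satisfies $$\frac{dH}{dt}\le -\alpha H+\beta\|\mathbf{d}\|^2,$$ where $\alpha,\beta>0$ are constants and $\|\mathbf{d}\|=\sqrt{\sum_{i=1}^k d_i^2}$. Here $\frac{dH}{dt}=\nabla H(\mathbf{x})^\top\dot{\mathbf{x}}$. *)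

(* Defs.v *)
From HB Require Import structures.
From mathcomp Require Import all_boot all_order all_algebra.
From mathcomp Require Import all_classical all_reals all_analysis.

Set Implicit Arguments.
Unset Strict Implicit.
Unset Printing Implicit Defensive.

Import Order.TTheory GRing.Theory Num.Theory.
Import numFieldNormedType.Exports.

Local Open Scope classical_set_scope.
Local Open Scope ring_scope.

Definition skew_symmetric_mx (R : realType) (n : nat) (A : 'M[R]_n) : Prop :=
  A^T = - A.

Definition psd_mx (R : realType) (n : nat) (A : 'M[R]_n) : Prop :=
  A^T = A /\ forall v : 'cV[R]_n, 0 <= (v^T *m A *m v) 0 0.

(* The library norm `|d| on matrices is the maximum norm, hence this one. *)
Definition norm2 (R : realType) (k : nat) (d : 'cV[R]_k) : R :=
  Num.sqrt (\sum_(i < k) d i 0 ^+ 2).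

Definition gradient (R : realType) (n : nat) (H : 'cV[R]_n -> R)
    (x : 'cV[R]_n) : 'cV[R]_n :=
  \col_(i < n) 'D_(delta_mx i 0) H x.

(* State dimension n, disturbance dimension k, control dimension m. *)
Record port_hamiltonian (R : realType) (n k m : nat) : Type := PortHamiltonian {
  ph_J : 'cV[R]_n -> 'M[R]_n;
  ph_R : 'cV[R]_n -> 'M[R]_n;
  ph_B : 'cV[R]_n -> 'M[R]_(n, k);
  ph_C : 'cV[R]_n -> 'M[R]_(n, m);
  ph_H : 'cV[R]_n -> R;
  ph_J_skew : forall x, skew_symmetric_mx (ph_J x);
  ph_R_psd : forall x, psd_mx (ph_R x);
  ph_H_diff : forall x, differentiable ph_H x
}.

Definition ph_rhs (R : realType) (n k m : nat) (S : port_hamiltonian R n k m)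
    (x : 'cV[R]_n) (d : 'cV[R]_k) (u : 'cV[R]_m) : 'cV[R]_n :=
  (ph_J S x - ph_R S x) *m gradient (ph_H S) x
    + ph_B S x *m d + ph_C S x *m u.

Definition ph_solution (R : realType) (n k m : nat)
    (S : port_hamiltonian R n k m) (I : set R)
    (x : R -> 'cV[R]_n) (d : R -> 'cV[R]_k) (u : R -> 'cV[R]_m) : Prop :=
  forall t, I t ->
    derivable x t 1 /\ x^`()%classic t = ph_rhs S (x t) (d t) (u t).

(* Solutions live on arbitrary open time intervals and no regularity is asked
   of the disturbance; (ph_H S \o x)^`() is the time derivative of H along the
   solution, see dHdtE below. *)
Definition ph_iss (R : realType) (n k m : nat) (S : port_hamiltonian R n k m)
    (h : 'cV[R]_n -> 'cV[R]_m) (alpha beta : R) : Prop :=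
  [/\ 0 < alpha, 0 < beta &
    forall (I : set R) (x : R -> 'cV[R]_n) (d : R -> 'cV[R]_k),
      is_interval I -> open I -> ph_solution S I x d (h \o x) ->
      forall t, I t ->
        (ph_H S \o x)^`()%classic t
          <= - alpha * ph_H S (x t) + beta * norm2 (d t) ^+ 2].

Lemma gradientE (R : realType) (n : nat) (H : 'cV[R]_n -> R)
    (x v : 'cV[R]_n) :
  differentiable H x -> 'D_v H x = ((gradient H x)^T *m v) 0 0.
Proof.
move=> dH; rewrite deriveE // mxE.
have -> : v = \sum_(i < n) v i 0 *: delta_mx i 0.
  by rewrite [LHS]matrix_sum_delta; apply: eq_bigr => i _; rewrite big_ord1.
rewrite linear_sum; apply: eq_bigr => i _.
rewrite linearZ /= !mxE deriveE // [RHS]mulrC; congr (_ * _).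
rewrite summxE (bigD1 i) //= !mxE !eqxx mulr1 big1 ?addr0 // => j ji.
by rewrite !mxE eq_sym (negbTE ji) mulr0.
Qed.

Lemma dHdtE (R : realType) (n : nat) (H : 'cV[R]_n -> R) (x : R -> 'cV[R]_n)
    (t : R) :
  differentiable H (x t) -> derivable x t 1 ->
  derivable (H \o x) t 1 /\
  (H \o x)^`()%classic t = ((gradient H (x t))^T *m x^`()%classic t) 0 0.
Proof.
move=> dH /derivable1_diffP dx.
have dHx : differentiable (H \o x) t by exact: differentiable_comp.
split; first exact/derivable1_diffP.
by rewrite derive1E' // diff_comp //= -gradientE // deriveE // derive1E'.
Qed.

(* Main.v *)
Require Import Defs.
From HB Require Import structures.
From mathcomp Require Import all_boot all_order all_algebra.
From mathcomp Require Import all_classical all_reals all_analysis.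
From mathcomp Require Import ring lra.

Set Implicit Arguments.
Unset Strict Implicit.
Unset Printing Implicit Defensive.

Import Order.TTheory GRing.Theory Num.Theory.
Import numFieldNormedType.Exports.

Local Open Scope classical_set_scope.
Local Open Scope ring_scope.

(** Write g for the gradient of H along a solution. By the chain rule [dHdtE], dH/dt = g^T J g - g^T
    R g + g^T B d + g^T C h. The first term vanishes ([skew_symmetric_form0]), and Young's
    inequality ([young_dotmx]) bounds g^T B d by g^T B B^T g / (4 beta) + beta |d|^2. Apart from
    beta |d|^2, what is left is the bracket of [h_cond] paired with g, hence at most - alpha H. *)

(** A 1 x 1 matrix is its own transpose, while skewness turns this transpose into the opposite. *)
Lemma skew_symmetric_form0 (R : realType) (n : nat) (A : 'M[R]_n)
    (v : 'cV[R]_n) :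
  skew_symmetric_mx A -> (v^T *m A *m v) 0 0 = 0.
Proof.
move=> skewA; have : (v^T *m A *m v)^T = - (v^T *m A *m v).
  by rewrite !trmx_mul trmxK skewA mulNmx mulmxN mulmxA.
by move=> /matrixP/(_ 0 0); rewrite !mxE; lra.
Qed.

(** Complete the square in each coordinate; the weight is chosen so that |d|^2 gets exactly the gain
    [beta]. *)
Lemma young_dotmx (R : realType) (k : nat) (beta : R) (w d : 'cV[R]_k) :
  0 < beta ->
  (w^T *m d) 0 0 <= 1 / (4 * beta) * (w^T *m w) 0 0 + beta * norm2 d ^+ 2.
Proof.
move=> beta_gt0; rewrite sqr_sqrtr; last by apply: sumr_ge0 => i _; exact: sqr_ge0.
rewrite !mxE !mulr_sumr -big_split; apply: ler_sum => i _ /=; rewrite !mxE.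
rewrite -subr_ge0.
have -> : 1 / (4 * beta) * (w i 0 * w i 0) + beta * d i 0 ^+ 2 - w i 0 * d i 0
    = beta * (d i 0 - w i 0 / (2 * beta)) ^+ 2.
  by field; rewrite gt_eqF.
by rewrite mulr_ge0 ?sqr_ge0 ?ltW.
Qed.

Theorem theorem3p2 (R : realType) (n k m : nat) (alpha beta : R)
    (alpha_gt0 : 0 < alpha) (beta_gt0 : 0 < beta)
    (S : port_hamiltonian R n k m) (h : 'cV[R]_n -> 'cV[R]_m)
    (h_cond : forall x : 'cV[R]_n,
      ((gradient (ph_H S) x)^T *m
         (ph_C S x *m h x
          + (1 / (4 * beta)) *:
              (ph_B S x *m (ph_B S x)^T *m gradient (ph_H S) x)
          - ph_R S x *m gradient (ph_H S) x)) 0 0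
      + alpha * ph_H S x <= 0) :
  ph_iss S h alpha beta.
Proof.
split=> // I x d _ _ sol t It; have [dx xE] := sol t It.
have [_ ->] := dHdtE (ph_H_diff S (x t)) dx; rewrite xE.
have := h_cond (x t); move: (ph_J_skew S (x t)); rewrite /ph_rhs /=.
set g := gradient _ _ => /(skew_symmetric_form0 g) gJg.
(* With w = B^T g, w^T d is the disturbance term and w^T w = g^T B B^T g is the quadratic term of
   [h_cond]. *)
have := young_dotmx ((ph_B S (x t))^T *m g) (d t) beta_gt0.
rewrite trmx_mul trmxK !mulmxDr mulmxN mulmxBl mulmxBr -!scalemxAr !mulmxA.
by move: gJg; rewrite !mxE; lra.
Qed.
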